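(* Let $k\in\{1,2,\ldots\}$, let $\Omega\subset\mathbb{R}$ be an open set, and let $X(\Omega)$ be a Banach lattice over $\Omega$. Assume that $\mathcal{Y}_k(\Omega)\hookrightarrow X(\Omega)$, i.e. $\mathcal{Y}_k(\Omega)$ is continuously embedded in $X(\Omega)$. Then $$\overline{H_{\mathrm{ReLU}^k}(\Omega)}^{\|\cdot\|_{X(\Omega)}}=\overline{\mathbb{C}\,(\mathrm{ReLU}^k_+|\Omega)+\mathbb{C}\,(\mathrm{ReLU}^k_-|\Omega)+C_{\mathrm{c}}(\mathbb{R})|\Omega}^{\|\cdot\|_{X(\Omega)}},$$ where the overline denotes closure in $X(\Omega)$ with respect to $\|\cdot\|_{X(\Omega)}$.
   Context: Functions are complex-valued and linear spans are taken over $\mathbb{C}$. $L^0(\Omega)$ denotes the set of all Lebesgue measurable functions from $\Omega$ to $\mathbb{C}$ (functions equal a.e. being identified). A Banach space $X(\Omega)\subset L^0(\Omega)$ with norm $\|\cdot\|_{X(\Omega)}$ is called a Banach lattice if, whenever $f\in L^0(\Omega)$ and $g\in X(\Omega)$ satisfy $|f(x)|\le|g(x)|$ for a.e. $x\in\Omega$, one has $f\in X(\Omega)$ and $\|f\|_{X(\Omega)}\le\|g\|_{X(\Omega)}$. For $x\in\mathbb{R}$: $\mathrm{ReLU}^k(x)=\mathrm{ReLU}^k_+(x)=\max(0,x)^k$ and $\mathrm{ReLU}^k_-(x)=\mathrm{ReLU}^k_+(-x)$. $\mathcal{Y}_k(\mathbb{R})$ is the space of all continuous functions $f$ on $\mathbb{R}$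 for which both limits $\lim_{x\to\infty}\frac{f(x)}{1+|x|^k}$ and $\lim_{x\to-\infty}\frac{f(x)}{1+|x|^k}$ exist (as finite numbers, not necessarily equal), with norm $\|f\|_{\mathcal{Y}_k}=\sup_{x\in\mathbb{R}}\frac{|f(x)|}{1+|x|^k}$. The space $\mathcal{Y}_k(\Omega)$ is $\{g|\Omega: g\in\mathcal{Y}_k(\mathbb{R})\}$ (restrictions to $\Omega$) with norm $\|f\|_{\mathcal{Y}_k(\Omega)}=\inf\{\|g\|_{\mathcal{Y}_k}: g\in\mathcal{Y}_k(\mathbb{R}),\ f=g|\Omega\}$. $H_{\mathrm{ReLU}^k}(\mathbb{R})$ is the linear span of the functions $x\mapsto\mathrm{ReLU}^k(ax+b)$ with $a,b\in\mathbb{R}$, $a\ne0$, and $H_{\mathrm{ReLU}^k}(\Omega)=\{g|\Omega: g\in H_{\mathrm{ReLU}^k}(\mathbb{R})\}$. $C_{\mathrm{c}}(\mathbb{R})$ is the space of compactly supported continuous functions on $\mathbb{R}$, and $C_{\mathrm{c}}(\mathbb{R})|\Omega$ is the set of their restrictions to $\Omega$. *)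

(* Defs.v *)
From HB Require Import structures.
From mathcomp Require Import all_boot all_order all_algebra.
From mathcomp Require Import complex.
From mathcomp Require Import all_classical all_reals all_analysis.
From mathcomp Require Import measurable_realfun.

Set Implicit Arguments.
Unset Strict Implicit.
Unset Printing Implicit Defensive.

Import Order.TTheory GRing.Theory Num.Theory.
Import ComplexField.
Import numFieldNormedType.Exports.

Local Open Scope classical_set_scope.
Local Open Scope ring_scope.
Local Open Scope complex_scope.
Local Open Scope quotient_scope.

(* Functions on Omega, a subset of R, are represented by total functions
   R -> R[i] of which only the values on Omega matter. *)

(* The reals with the Lebesgue (i.e. completed Borel) sigma-algebra; the
   completed Lebesgue measure lives on this type. *)
Definition lebesgueR (R : realType) :=
  caratheodory_type ((wlength (@idfun R))^*)%mu.

Section L0.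
Context (R : realType) (Omega : set R).

Let mu := @completed_lebesgue_measure R.

Definition Lmeasurable (f : R -> R[i]) : Prop :=
  measurable_fun Omega ((fun x => complex.Re (f x)) : lebesgueR R -> R) /\
  measurable_fun Omega ((fun x => complex.Im (f x)) : lebesgueR R -> R).

Definition ae_eq_on (f g : R -> R[i]) : Prop := ae_eq mu Omega f g.

Record L0fun := MkL0fun {
  L0fun_val :> R -> R[i];
  L0fun_meas : Lmeasurable L0fun_val }.

HB.instance Definition _ := gen_eqMixin L0fun.
HB.instance Definition _ := gen_choiceMixin L0fun.

Definition L0_rel (f g : L0fun) : bool := `[< ae_eq_on f g >].

Let L0_rel_refl : reflexive L0_rel.
Proof. by move=> f; apply/asboolP; exact: ae_eq_refl. Qed.

Let L0_rel_sym : symmetric L0_rel.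
Proof. by move=> f g; apply/idP/idP => /asboolP h; apply/asboolP/ae_eq_sym. Qed.

Let L0_rel_trans : transitive L0_rel.
Proof.
move=> f g h /asboolP gf /asboolP fh.
by apply/asboolP/(ae_eq_trans gf fh).
Qed.

Canonical L0_rel_canonical :=
  EquivRel L0_rel L0_rel_refl L0_rel_sym L0_rel_trans.

Definition L0 : Type := {eq_quot L0_rel}.
HB.instance Definition _ := Choice.on L0.
HB.instance Definition _ := EqQuotient.on L0.

Lemma L0_pi (f g : L0fun) : \pi_L0 f = \pi_L0 g <-> ae_eq_on f g.
Proof.
split=> [/eqP|fg]; first by rewrite eqmodE => /asboolP.
by apply/eqP; rewrite eqmodE; apply/asboolP.
Qed.

Lemma L0_reprK (f : L0fun) : ae_eq_on (repr (\pi_L0 f)) f.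
Proof. by apply/L0_pi; rewrite reprK. Qed.

Lemma Lmeasurable0 : Lmeasurable (fun=> 0).
Proof. by split; exact: measurable_cst. Qed.

Lemma LmeasurableD f g :
  Lmeasurable f -> Lmeasurable g -> Lmeasurable (fun x => f x + g x).
Proof.
move=> [rf jf] [rg jg]; split.
  rewrite (_ : (fun x => _) =
    (fun x => complex.Re (f x) + complex.Re (g x))).
    exact: measurable_funD.
  by apply/funext => x; case: (f x) (g x) => [? ?] [? ?].
rewrite (_ : (fun x => _) = (fun x => complex.Im (f x) + complex.Im (g x))).
  exact: measurable_funD.
by apply/funext => x; case: (f x) (g x) => [? ?] [? ?].
Qed.

Lemma LmeasurableZ (c : R[i]) f :
  Lmeasurable f -> Lmeasurable (fun x => c * f x).
Proof.
move=> [rf jf]; case: c => a b; split.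
  rewrite (_ : (fun x => _) =
    (fun x => a * complex.Re (f x) - b * complex.Im (f x))).
    by apply: measurable_funB; apply: measurable_funM => //;
      exact: measurable_cst.
  by apply/funext => x; case: (f x).
rewrite (_ : (fun x => _) =
  (fun x => a * complex.Im (f x) + b * complex.Re (f x))).
  by apply: measurable_funD; apply: measurable_funM => //;
    exact: measurable_cst.
by apply/funext => x; case: (f x).
Qed.

Definition L0fun0 := MkL0fun Lmeasurable0.
Definition L0funD (f g : L0fun) :=
  MkL0fun (LmeasurableD (L0fun_meas f) (L0fun_meas g)).
Definition L0funZ (c : R[i]) (f : L0fun) :=
  MkL0fun (LmeasurableZ c (L0fun_meas f)).

Definition L0_zero : L0 := \pi_L0 L0fun0.
Definition L0_add (u v : L0) : L0 := \pi_L0 (L0funD (repr u) (repr v)).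
Definition L0_scale (c : R[i]) (u : L0) : L0 := \pi_L0 (L0funZ c (repr u)).
Definition L0_opp : L0 -> L0 := L0_scale (-1).

Lemma L0_addE f g : L0_add (\pi_L0 f) (\pi_L0 g) = \pi_L0 (L0funD f g).
Proof.
apply/L0_pi; have ff := L0_reprK f; have gg := L0_reprK g.
rewrite /ae_eq_on /ae_eq in ff gg *.
by near=> x => Ox /=; rewrite (near ff)// (near gg).
Unshelve. all: by end_near.
Qed.

Lemma L0_scaleE c f : L0_scale c (\pi_L0 f) = \pi_L0 (L0funZ c f).
Proof.
apply/L0_pi; have ff := L0_reprK f; rewrite /ae_eq_on /ae_eq in ff *.
by near=> x => Ox /=; rewrite (near ff).
Unshelve. all: by end_near.
Qed.

Let L0_surj (u : L0) : exists f, u = \pi_L0 f.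
Proof. by exists (repr u); rewrite reprK. Qed.

Let L0_pi_ext (f g : L0fun) : (forall x, f x = g x) -> \pi_L0 f = \pi_L0 g.
Proof. by move=> fg; apply/L0_pi; apply: aeW => x _. Qed.

Let L0_addA : associative L0_add.
Proof.
move=> u v w; have [[f ->] [g ->] [h ->]] :=
  And3 (L0_surj u) (L0_surj v) (L0_surj w).
rewrite (L0_addE g h) (L0_addE f g) !L0_addE.
by apply: L0_pi_ext => x /=; rewrite addrA.
Qed.

Let L0_addC : commutative L0_add.
Proof.
move=> u v; have [[f ->] [g ->]] := conj (L0_surj u) (L0_surj v).
by rewrite !L0_addE; apply: L0_pi_ext => x /=; rewrite addrC.
Qed.

Let L0_add0 : left_id L0_zero L0_add.
Proof.
by move=> u; have [f ->] := L0_surj u; rewrite L0_addE;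
  apply: L0_pi_ext => x /=; rewrite add0r.
Qed.

Let L0_addN : left_inverse L0_zero L0_opp L0_add.
Proof.
move=> u; have [f ->] := L0_surj u; rewrite /L0_opp L0_scaleE L0_addE.
by apply: L0_pi_ext => x /=; rewrite mulN1r addNr.
Qed.

HB.instance Definition _ :=
  GRing.isZmodule.Build L0 L0_addA L0_addC L0_add0 L0_addN.

Let L0_scaleA a b u : L0_scale a (L0_scale b u) = L0_scale (a * b) u.
Proof.
have [f ->] := L0_surj u; rewrite (L0_scaleE b f) !L0_scaleE.
by apply: L0_pi_ext => x /=; rewrite mulrA.
Qed.

Let L0_scale1 : left_id 1 L0_scale.
Proof.
by move=> u; have [f ->] := L0_surj u; rewrite L0_scaleE;
  apply: L0_pi_ext => x /=; rewrite mul1r.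
Qed.

Let L0_scaleDr : right_distributive L0_scale +%R.
Proof.
move=> c u v; have [[f ->] [g ->]] := conj (L0_surj u) (L0_surj v).
rewrite [\pi_L0 f + _]L0_addE (L0_scaleE c f) (L0_scaleE c g) L0_scaleE.
rewrite [RHS]L0_addE.
by apply: L0_pi_ext => x /=; rewrite mulrDr.
Qed.

Let L0_scaleDl u : {morph L0_scale^~ u : a b / a + b}.
Proof.
move=> a b; have [f ->] := L0_surj u; rewrite !L0_scaleE [RHS]L0_addE.
by apply: L0_pi_ext => x /=; rewrite mulrDl.
Qed.

HB.instance Definition _ :=
  GRing.Zmodule_isLmodule.Build R[i] L0
    L0_scaleA L0_scale1 L0_scaleDr L0_scaleDl.

Definition class_of (f : R -> R[i]) (u : L0) : Prop := ae_eq_on f (repr u).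

Definition L0_dominated (u v : L0) : Prop :=
  {ae mu, forall x, Omega x -> `|repr u x| <= `|repr v x|}.

End L0.

(* A linear subspace of L^0(Omega) with its own complete norm is given by a
   Banach space with an injective linear map to L^0(Omega). *)
Record banachLattice (R : realType) (Omega : set R) := BanachLattice {
  lattice_space :> completeNormedModType R[i];
  to_L0 : {linear lattice_space -> L0 Omega};
  to_L0_inj : injective to_L0;
  to_L0_solid : forall (f : L0 Omega) (g : lattice_space),
    L0_dominated f (to_L0 g) -> exists2 h, to_L0 h = f & `|h| <= `|g| }.

Definition elements_in (R : realType) (Omega : set R) (X : banachLattice Omega)
    (A : set (R -> R[i])) : set X :=
  [set x : X | exists2 f, A f & class_of f (to_L0 X x)].
Arguments elements_in {R Omega} X A.

Section spaces.
Context (R : realType).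

Definition restrictions (Omega : set R) (A : set (R -> R[i])) :
    set (R -> R[i]) :=
  [set f : R -> R[i] | exists2 g, A g & {in Omega, f =1 g}].

Definition linear_span (A : set (R -> R[i])) : set (R -> R[i]) :=
  [set f : R -> R[i] |
    exists (n : nat) (c : 'I_n -> R[i]) (g : 'I_n -> R -> R[i]),
      (forall i, A (g i)) /\ f = (fun x => \sum_(i < n) c i * g i x)].

Definition ReLU (k : nat) (x : R) : R := Num.max 0 x ^+ k.

Definition ReLUp (k : nat) : R -> R[i] := fun x => (ReLU k x)%:C.
Definition ReLUm (k : nat) : R -> R[i] := fun x => (ReLU k (- x))%:C.

Definition H_ReLU (k : nat) : set (R -> R[i]) :=
  linear_span [set f : R -> R[i] | exists a b : R,
    a != 0 /\ f = (fun x => (ReLU k (a * x + b))%:C)].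

Definition Cc : set (R -> R[i]) :=
  [set f : R -> R[i] | continuous (f : R -> R[i]^o) /\
           compact (closure [set x | f x != 0])].

Definition ReLU_pm_Cc (k : nat) : set (R -> R[i]) :=
  [set f : R -> R[i] | exists (a b : R[i]) (h : R -> R[i]),
    Cc h /\ f = (fun x => a * ReLUp k x + b * ReLUm k x + h x)].

Definition growth_quotient (k : nat) (f : R -> R[i]) : R -> R[i]^o :=
  fun x => f x / (1 + `|x| ^+ k)%:C.

Definition Yk (k : nat) : set (R -> R[i]) :=
  [set f : R -> R[i] | [/\ continuous (f : R -> R[i]^o),
               cvg (growth_quotient k f x @[x --> +oo]) &
               cvg (growth_quotient k f x @[x --> -oo])]].

(* [normc] is the real-valued modulus; the set below is bounded for f in
   [Yk k], so that [sup] is its genuine supremum. *)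
Definition Yk_norm (k : nat) (f : R -> R[i]) : R :=
  sup (range (fun x : R => Normc.normc (f x) / (1 + `|x| ^+ k))).

Definition Yk_on (k : nat) (Omega : set R) : set (R -> R[i]) :=
  restrictions Omega (Yk k).

Definition Yk_on_norm (k : nat) (Omega : set R) (f : R -> R[i]) : R :=
  inf [set Yk_norm k g | g in
    [set g : R -> R[i] | Yk k g /\ {in Omega, f =1 g}]].

End spaces.

(* Norms in X(Omega) are R[i]-valued (with real values), hence the cast. *)
Definition Yk_embedded (R : realType) (k : nat) (Omega : set R)
    (X : banachLattice Omega) : Prop :=
  exists M : R, forall f : R -> R[i], Yk_on k Omega f ->
    exists2 x : X, class_of f (to_L0 X x) &
      `|x| <= (M * Yk_on_norm k Omega f)%:C.

(* Main.v *)
Require Import Defs.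
From mathcomp Require Import all_boot all_order all_algebra.
From mathcomp Require Import complex ring lra.
From mathcomp Require Import all_classical all_reals all_analysis.

Set Implicit Arguments.
Unset Strict Implicit.
Unset Printing Implicit Defensive.

Import Order.TTheory GRing.Theory Num.Theory.
Import Normc.
Import numFieldNormedType.Exports.

Local Open Scope classical_set_scope.
Local Open Scope ring_scope.
Local Open Scope complex_scope.
Local Open Scope quotient_scope.

(* Both sides are compared in the weighted sup norm of Y_k, which dominates the
   norm of X.

   A function f of Y_k becomes o(1 + |x|^k) after subtracting suitable multiples
   of ReLU^k_+ and ReLU^k_-, and is then a limit of its cutoffs; since
   H_{ReLU^k} is contained in Y_k, this gives one inclusion.

   For the other, difference quotients in the shift parameter show that the
   weighted closure of H_{ReLU^k} contains the translates of ReLU^{k-1}, hence,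
   descending, those of ReLU^1.  It therefore contains all hat functions, and
   piecewise linear interpolation yields every element of C_c. *)

Section Approximation.
Context (R : realType).
Implicit Types (A B : set (R -> R[i])) (f g h : R -> R[i]) (k : nat) (Omega : set R).

(** * The complex modulus, linear sets of functions, weighted approximation *)

Lemma normc_ge0 (z : R[i]) : 0 <= normc z.
Proof. by case: z => a b; exact: sqrtr_ge0. Qed.

Lemma normcR (a : R) : normc a%:C = `|a|.
Proof. by rewrite /normc /= expr0n addr0 sqrtr_sqr. Qed.

Lemma normc_sum n (z : 'I_n -> R[i]) :
  normc (\sum_(i < n) z i) <= \sum_(i < n) normc (z i).
Proof.
elim/big_rec2: _ => [|i b a _ ih]; first by rewrite normcR normr0.
by rewrite (le_trans (le_normcD _ _))// lerD2l.
Qed.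

Definition submodule A : Prop :=
  A (fun=> 0) /\ forall c f g, A f -> A g -> A (fun x => c * f x + g x).

Lemma submodule_sum A n (c : 'I_n -> R[i]) (f : 'I_n -> R -> R[i]) :
  submodule A -> (forall i, A (f i)) -> A (fun x => \sum_(i < n) c i * f i x).
Proof.
move=> [A0 Alin]; elim: n c f => [|n ih] c f Af.
  by rewrite (_ : (fun x => _) = fun=> 0)//; apply/funext=> x; rewrite big_ord0.
rewrite (_ : (fun x => _) = fun x => c ord0 * f ord0 x +
    \sum_(i < n) c (lift ord0 i) * f (lift ord0 i) x).
  exact/Alin/ih.
by apply/funext=> x; rewrite big_ord_recl.
Qed.

Lemma submoduleZ A c f : submodule A -> A f -> A (fun x => c * f x).
Proof.
move=> [A0 Alin] Af; rewrite (_ : (fun x => _) = fun x => c * f x + 0).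
  exact: Alin.
by apply/funext=> x; rewrite addr0.
Qed.

Lemma submoduleB A f g : submodule A -> A f -> A g -> A (fun x => f x - g x).
Proof.
move=> [A0 Alin] Af Ag; rewrite (_ : (fun x => _) = fun x => -1 * g x + f x).
  exact: Alin.
by apply/funext=> x; rewrite mulN1r addrC.
Qed.

Lemma submodule_span A : submodule (linear_span A).
Proof.
split.
  exists 0%N, (fun=> 0), (fun=> fun=> 0); split; first by case.
  by apply/funext=> x; rewrite big_ord0.
move=> c _ _ [n [a [f [Af ->]]]] [m [b [g [Ag ->]]]].
exists (n + m)%N, (fun i : 'I_(n + m) =>
    match fintype.split i with inl j => c * a j | inr j => b j end),
  (fun i : 'I_(n + m) =>
    match fintype.split i with inl j => f j | inr j => g j end); split.
  by move=> i; case: (fintype.split i).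
apply/funext=> x; rewrite big_split_ord/= mulr_sumr; congr (_ + _).
  apply: eq_bigr => i _; case: splitP => [j /= /ord_inj <-|j /= e].
    by rewrite mulrA.
  by have := ltn_ord i; rewrite e ltnNge leq_addr.
apply: eq_bigr => i _; case: splitP => [j /= e|j /= /addnI /ord_inj <-//].
by have := ltn_ord j; rewrite -e ltnNge leq_addr.
Qed.

Lemma span_sub A f : A f -> linear_span A f.
Proof.
move=> Af; exists 1%N, (fun=> 1), (fun=> f); split=> //.
by apply/funext=> x; rewrite big_ord1 mul1r.
Qed.

(** Closure of [A] in the weighted sup norm, spelled out by pointwise bounds so that no supremum has
    to be handled. *)
Definition wapprox k A : set (R -> R[i]) :=
  [set f | forall e : R, 0 < e ->
    exists2 g, A g & forall x, normc (f x - g x) <= e * (1 + `|x| ^+ k)].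

Lemma weight_gt0 k (x : R) : 0 < 1 + `|x| ^+ k.
Proof. by rewrite ltr_pwDl// exprn_ge0. Qed.

Lemma wapprox_sub k A f : A f -> wapprox k A f.
Proof.
move=> Af e e0; exists f => // x.
by rewrite subrr normcR normr0 mulr_ge0 ?(ltW e0) ?(ltW (weight_gt0 _ _)).
Qed.

Lemma wapprox_idem k A f : wapprox k (wapprox k A) f -> wapprox k A f.
Proof.
move=> Af e e0; have e20 : 0 < e / 2 by lra.
have [g Ag fg] := Af _ e20; have [h Ah gh] := Ag _ e20.
exists h => // x; rewrite -(subrKA (g x)).
by apply: (le_trans (le_normcD _ _)); have := fg x; have := gh x; lra.
Qed.

Lemma submodule_wapprox k A : submodule A -> submodule (wapprox k A).
Proof.
move=> sA; split; first exact/wapprox_sub/sA.1.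
move=> c f g Af Ag e e0; have c0 := normc_ge0 c.
(* The summand 1 keeps the denominator positive when [c = 0]; below, only
   [normc c / (1 + normc c) <= 1] matters. *)
have e10 : 0 < e / (2 * (1 + normc c)) by rewrite divr_gt0 ?mulr_gt0 //; lra.
have e20 : 0 < e / 2 by lra.
have [f' Af' ff'] := Af _ e10; have [g' Ag' gg'] := Ag _ e20.
exists (fun x => c * f' x + g' x); first exact: sA.2.
move=> x; rewrite (_ : _ - _ = c * (f x - f' x) + (g x - g' x)); last by ring.
apply: (le_trans (le_normcD _ _)); rewrite normcM.
have w0 := weight_gt0 k x; set w := 1 + _ in w0 *.
have -> : e * w = e / 2 * w + e / 2 * w by field.
apply: lerD; last exact: gg'.
apply: (le_trans (ler_wpM2l c0 (ff' x))); rewrite mulrA ler_wpM2r ?(ltW w0)//.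
have -> : normc c * (e / (2 * (1 + normc c))) = e / 2 * (normc c / (1 + normc c)).
  by field; lra.
by rewrite ler_piMr ?(ltW e20)// ler_pdivrMr ?mul1r; lra.
Qed.

(** * Difference quotients of powers of ReLU *)

Lemma ReLU1E (x : R) : ReLU 1 x = Num.max 0 x.
Proof. by rewrite /ReLU expr1. Qed.

Lemma maxr0_cases (x : R) : (0 <= x /\ Num.max 0 x = x) \/ (x <= 0 /\ Num.max 0 x = 0).
Proof. by case: (leP 0 x) => x0; [left|right]; split; rewrite ?ltW. Qed.

(** Bound [1 + y] by 2 when [y <= 1] and by [2 * y] otherwise. This brings polynomial error bounds
    back to the weight. *)
Lemma expr1D_le (y : R) k : 0 <= y -> (1 + y) ^+ k <= 2 ^+ k * (1 + y ^+ k).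
Proof.
move=> y0; have yk : 0 <= y ^+ k by rewrite exprn_ge0.
have tk : 0 <= (2 : R) ^+ k by rewrite exprn_ge0.
have [y1|/ltW y1] := leP y 1.
  have : (1 + y) ^+ k <= 2 ^+ k by apply: lerXn2r; rewrite ?nnegrE; lra.
  by nra.
have : (1 + y) ^+ k <= (2 * y) ^+ k by apply: lerXn2r; rewrite ?nnegrE; lra.
by rewrite exprMn; nra.
Qed.

(** Induction on the exponent, which starts at 2: the quotient of ReLU^1 does not converge uniformly
    near the kink, whereas an extra factor [p] or [q] is small there. *)
Lemma ReLU_diffq (u d : R) j : 0 < d <= 1 ->
  `|(ReLU j.+2 (u + d) - ReLU j.+2 u) / d - j.+2%:R * ReLU j.+1 u|
    <= j.+2%:R ^+ 2 * d * (1 + `|u|) ^+ j.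
Proof.
move=> /andP[d0 d1]; rewrite /ReLU; set p := Num.max 0 u; set q := Num.max 0 (u + d).
have p0 : 0 <= p by rewrite /p le_max lexx.
have q0 : 0 <= q by rewrite /q le_max lexx.
have pu : p <= `|u| by rewrite /p ge_max normr_ge0 ler_norm.
have qu : q <= 1 + `|u| by rewrite /q ge_max; have := ler_norm u; lra.
have qp : 0 <= q - p <= d.
  by rewrite /p /q; case: (maxr0_cases u) => -[? ->];
    case: (maxr0_cases (u + d)) => -[? ->]; lra.
(* Either [u <= 0] and [p = 0], or [u >= 0] and [q - p = d]. *)
have pqd : p * ((q - p) / d - 1) = 0.
  rewrite /p /q; case: (maxr0_cases u) => -[? ->];
    case: (maxr0_cases (u + d)) => -[? ->]; try (field; lra); try (rewrite mul0r//).
  by have -> : u = 0 by [lra]; rewrite mul0r.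
(* Only [p = 0] is left by [pqd]; then [q] lies in [0, d]. *)
have qd : `|q * ((q - p) / d - 1)| <= d.
  have [p00|pN0] := eqVneq p 0; last first.
    by move/eqP: pqd; rewrite mulf_eq0 (negbTE pN0)/= => /eqP ->;
      rewrite mulr0 normr0 ltW.
  rewrite p00 subr0 in qp *.
  have -> : q * (q / d - 1) = - (q * (d - q) / d) by field; lra.
  rewrite normrN ger0_norm; last by rewrite divr_ge0 ?mulr_ge0; lra.
  by rewrite ler_pdivrMr//; nra.
elim: j => [|j ih].
  rewrite expr0 mulr1 expr1.
  have -> : (q ^+ 2 - p ^+ 2) / d - 2 * p =
    q * ((q - p) / d - 1) + p * ((q - p) / d - 1) + (q - p) by field; lra.
  rewrite pqd addr0; apply: (le_trans (ler_normD _ _)).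
  by rewrite (ger0_norm (x := q - p)); lra.
(* The discrete product rule: the induction hypothesis bounds the first term, [q - p <= d] the
   second, and the third vanishes by [pqd]. *)
have -> : (q ^+ j.+3 - p ^+ j.+3) / d - j.+3%:R * p ^+ j.+2 =
  q * ((q ^+ j.+2 - p ^+ j.+2) / d - j.+2%:R * p ^+ j.+1)
  + j.+2%:R * p ^+ j.+1 * (q - p) + p ^+ j.+1 * (p * ((q - p) / d - 1)).
  rewrite -(natr1 j.+2) !exprS; set N := j.+2%:R; set a := q ^+ j; set b := p ^+ j.
  by field; lra.
rewrite pqd mulr0 addr0; apply: (le_trans (ler_normD _ _)).
rewrite normrM (ger0_norm q0).
rewrite (ger0_norm (x := _ * (q - p))); last first.
  by rewrite !mulr_ge0 ?exprn_ge0//; lra.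
set v := 1 + `|u| in qu ih *; move: ih; set W := _ - j.+2%:R * _.
have D0 := normr_ge0 W; move: `|W| D0 => D D0 ih.
have v0 : 0 <= v by rewrite addr_ge0.
have h1 : q * D <= v * (j.+2%:R ^+ 2 * d * v ^+ j) by apply: ler_pM.
have h2 : p ^+ j.+1 * (q - p) <= v ^+ j.+1 * d.
  by apply: ler_pM; rewrite ?exprn_ge0//; [lra|
    apply: lerXn2r; rewrite ?nnegrE /v; lra |lra].
have h3 : 0 <= j.+2%:R :> R by [].
have h4 : 0 <= v ^+ j.+1 * d by rewrite mulr_ge0 ?exprn_ge0//; lra.
have h5 : j.+2%:R * (p ^+ j.+1 * (q - p)) <= j.+2%:R * (v ^+ j.+1 * d).
  by rewrite ler_wpM2l.
rewrite -(mulrA _ (p ^+ _)) -(natr1 j.+2).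
apply: (le_trans (lerD h1 h5)); rewrite exprS in h4 *.
set N := j.+2%:R in h3 *; set V := v ^+ j in h4 *.
(* The induction closes because N^2 + N <= (N + 1)^2. *)
rewrite -subr_ge0.
have -> : (N + 1) ^+ 2 * d * (v * V) - (v * (N ^+ 2 * d * V) + N * (v * V * d)) =
  (N + 1) * (v * V * d) by ring.
by rewrite mulr_ge0// addr_ge0.
Qed.

(** * Ramps and hat functions *)

Definition ramp (y : R) : R := Num.max 0 y - Num.max 0 (y - 1).
(** The tent on [-1, 1] with peak 1 at 0; as a difference of ramps, its integer shifts telescope. *)
Definition hat (y : R) : R := ramp (y + 1) - ramp y.

Lemma ramp_ge0 y : 0 <= ramp y.
Proof.
by rewrite /ramp; case: (maxr0_cases y) => -[? ->];
  case: (maxr0_cases (y - 1)) => -[? ->]; lra.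
Qed.

Lemma ramp_le1 y : ramp y <= 1.
Proof.
by rewrite /ramp; case: (maxr0_cases y) => -[? ->];
  case: (maxr0_cases (y - 1)) => -[? ->]; lra.
Qed.

Lemma ramp_eq0 y : y <= 0 -> ramp y = 0.
Proof.
by rewrite /ramp => y0; case: (maxr0_cases y) => -[? ->];
  case: (maxr0_cases (y - 1)) => -[? ->]; lra.
Qed.

Lemma ramp_eq1 y : 1 <= y -> ramp y = 1.
Proof.
by rewrite /ramp => y1; case: (maxr0_cases y) => -[? ->];
  case: (maxr0_cases (y - 1)) => -[? ->]; lra.
Qed.

Lemma hat_ge0 y : 0 <= hat y.
Proof.
rewrite /hat /ramp addrK; case: (maxr0_cases y) => -[? ->];
  case: (maxr0_cases (y - 1)) => -[? ->]; case: (maxr0_cases (y + 1)) => -[? ->]; lra.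
Qed.

Lemma hat_eq0 y : 1 <= `|y| -> hat y = 0.
Proof.
rewrite ler_normr => /orP[y1|y1]; rewrite /hat.
  by rewrite !ramp_eq1 ?subrr//; lra.
by rewrite !ramp_eq0 ?subrr//; lra.
Qed.

Lemma sum_hat n y : \sum_(i < n.+1) hat (y - i%:R) = ramp (y + 1) - ramp (y - n%:R).
Proof.
elim: n => [|n ih]; first by rewrite big_ord1 /hat subr0.
rewrite big_ord_recr/= ih /hat; have -> : y - n.+1%:R + 1 = y - n%:R.
  by rewrite -natr1; ring.
by ring.
Qed.

(** * The weighted closure of the span of ReLU^k *)

Lemma submodule_wapprox_H k : submodule (wapprox k (@H_ReLU R k)).
Proof. exact: submodule_wapprox (submodule_span _). Qed.

Lemma H_ReLU_affine k (a b : R) : a != 0 -> H_ReLU k (fun x => (ReLU k (a * x + b))%:C).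
Proof. by move=> a0; apply: span_sub; exists a, b. Qed.

(* Lower powers are limits of difference quotients of the higher ones. *)
Lemma wapprox_ReLU k i (t : R) : (i < k)%N ->
  wapprox k (H_ReLU k) (fun x => (ReLU (k - i) (x - t))%:C).
Proof.
have sW := submodule_wapprox_H k.
elim: i t => [|i ih] t ik.
  apply: wapprox_sub; rewrite subn0.
  rewrite (_ : (fun x => _) = fun x => (ReLU k (1 * x - t))%:C); last first.
    by apply/funext=> x; rewrite mul1r.
  exact/H_ReLU_affine/oner_neq0.
(* The target exponent is at least 1, so the one above it has the form [j.+2] that [ReLU_diffq]
   handles. *)
have [j kj] : exists j, (k - i.+1 = j.+1)%N.
  by exists (k - i.+1).-1; rewrite prednK// subn_gt0.
have kj1 : (k - i = j.+2)%N by rewrite -kj subnSK// ltnW.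
have jk : (j <= k)%N.
  by rewrite (leq_trans (leqnSn _))// (leq_trans (leqnSn _))// -kj1 leq_subr.
rewrite {}kj {}kj1 in ih *; apply: wapprox_idem => e e0.
(* [C] collects one factor [j.+2] (the other cancels on normalizing the quotient), the cost of the
   shift by [t], and the constant of [expr1D_le]. *)
pose C : R := j.+2%:R * (1 + `|t|) ^+ j * 2 ^+ k.
have C0 : 0 < C by rewrite !mulr_gt0// exprn_gt0// ltr_pwDl.
(* The bound 1 is required by [ReLU_diffq]; the bound [e / C] makes the error at most [e] times the
   weight. *)
pose d := Num.min 1 (e / C).
have d01 : 0 < d <= 1 by rewrite /d lt_min ltr01 divr_gt0//= ge_min lexx.
have dC : d * C <= e by rewrite -ler_pdivlMr// /d ge_min lexx orbT.
have [d0 d1] := andP d01.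
exists (fun x => (d * j.+2%:R)^-1%:C *
    ((ReLU j.+2 (x - (t - d)))%:C - (ReLU j.+2 (x - t))%:C)).
  by apply: (submoduleZ _ sW); apply: (submoduleB sW); apply: ih; exact: ltnW.
move=> x; rewrite -rmorphB -rmorphM -rmorphB normcR.
have := ReLU_diffq (x - t) j d01; have -> : x - (t - d) = x - t + d by ring.
set p := ReLU j.+2 (x - t); set q := ReLU j.+2 _; set r := ReLU j.+1 _ => hq.
have N0 : 0 < j.+2%:R :> R by [].
have -> : r - (d * j.+2%:R)^-1 * (q - p) = - (j.+2%:R^-1 * ((q - p) / d - j.+2%:R * r)).
  by set N := j.+2%:R in N0 *; field; lra.
rewrite normrN normrM ger0_norm ?invr_ge0// mulrC ler_pdivrMr//.
apply: (le_trans hq).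
(* Uses 1 + |x - t| <= (1 + |t|)(1 + |x|) and [j <= k]. *)
have wx : (1 + `|x - t|) ^+ j <= (1 + `|t|) ^+ j * (2 ^+ k * (1 + `|x| ^+ k)).
  apply: (@le_trans _ _ ((1 + `|t|) ^+ j * (1 + `|x|) ^+ j)).
    rewrite -exprMn; apply: lerXn2r; rewrite ?nnegrE ?mulr_ge0 ?addr_ge0//.
    have := ler_normB x t; have := normr_ge0 x; have := normr_ge0 t; nra.
  rewrite ler_wpM2l ?exprn_ge0 ?addr_ge0//.
  apply: le_trans (expr1D_le k (normr_ge0 x)).
  by apply: ler_weXn2l => //; rewrite lerDl.
have w0 := weight_gt0 k x; set w := 1 + `|x| ^+ k in w0 wx *.
apply: (@le_trans _ _ (j.+2%:R ^+ 2 * d * ((1 + `|t|) ^+ j * (2 ^+ k * w)))).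
  by rewrite ler_wpM2l// mulr_ge0 ?exprn_ge0// ltW.
have -> : j.+2%:R ^+ 2 * d * ((1 + `|t|) ^+ j * (2 ^+ k * w)) = d * C * w * j.+2%:R.
  by rewrite /C; ring.
by rewrite ler_wpM2r// ler_wpM2r// ltW.
Qed.

(** A hat is, up to the factor 1/d, a second difference of translates of ReLU^1; these are reached
    by descending [k.-1] times. *)
Lemma wapprox_hat k (d t : R) : (0 < k)%N -> 0 < d ->
  wapprox k (H_ReLU k) (fun x => (hat ((x - t) / d))%:C).
Proof.
move=> k0 d0.
have sW := submodule_wapprox_H k.
have RW s : wapprox k (H_ReLU k) (fun x => (ReLU 1 (x - s))%:C).
  by have := @wapprox_ReLU k k.-1 s; rewrite prednK// leqnn -subn1 subKn//; apply.
rewrite (_ : (fun x => _) = fun x => d^-1%:C * (((ReLU 1 (x - (t - d)))%:C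
    - (ReLU 1 (x - t))%:C) - ((ReLU 1 (x - t))%:C - (ReLU 1 (x - (t + d)))%:C))).
  by apply: (submoduleZ _ sW); apply: (submoduleB sW);
    apply: (submoduleB sW); exact: RW.
apply/funext=> x; rewrite -!rmorphB -rmorphM; congr (_%:C).
rewrite !ReLU1E /hat /ramp addrK.
have E s : Num.max 0 (s / d) = d^-1 * Num.max 0 s.
  by rewrite maxr_pMr ?invr_ge0 ?ltW// mulr0 mulrC.
have -> : (x - t) / d + 1 = (x - (t - d)) / d by field; lra.
have -> : (x - t) / d - 1 = (x - (t + d)) / d by field; lra.
by rewrite !E; ring.
Qed.

(** * Uniform continuity and interpolation in C_c *)

Lemma continuous_near_normc f (x e : R) : continuous (f : R -> R[i]^o) -> 0 < e ->
  \forall y \near x, normc (f x - f y) <= e.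
Proof.
move=> cf e0; have /cvgrPdist_le/(_ e%:C) := cf x.
rewrite ltcR => /(_ e0); apply: filterS => y.
by rewrite -lecR.
Qed.

Lemma Cc_support h : Cc h -> exists2 N : R, 0 < N & forall x, N <= `|x| -> h x = 0.
Proof.
move=> [_ /compact_bounded[M [_ hM]]].
exists (Num.max 1 (M + 1)); first by rewrite lt_max ltr01.
move=> x xM; apply/eqP/negPn/negP => hx.
(* A radius above [M], hence bounding the support, yet strictly below the chosen threshold. *)
have Mx : M < Num.max 1 (M + 1) - 2^-1.
  by rewrite ltrBrDr lt_max; apply/orP; right; lra.
have /= := hM _ Mx x (@subset_closure _ [set x | h x != 0] x hx).
by move=> /(le_trans xM); lra.
Qed.

(** Heine's theorem on a segment with margin 1 around the support; with [d < 1], a point outside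
    this segment has all its [d]-neighbours off the support too. *)
Lemma Cc_unif h (e : R) : Cc h -> 0 < e ->
  exists2 d : R, 0 < d & forall x y, `|x - y| < d -> normc (h x - h y) <= e.
Proof.
move=> hC e0; have [ch _] := hC; have [N N0 hN] := Cc_support hC.
have := @segment_compact R (- (N + 1)) (N + 1).
move=> /compact_near_coveringP/(_ R (0^'+) (fun d x =>
  forall y, `|x - y| < d -> normc (h x - h y) <= e)).
move=> cov.
have /cov : forall x, `[- (N + 1), N + 1]%classic x ->
    \forall x' \near x & d \near 0^'+,
    (fun d x => forall y, `|x - y| < d -> normc (h x - h y) <= e) d x'.
  move=> x _; have e20 : 0 < e / 2 by lra.
  have /nbhs_ballP[r /= r0 hr] := continuous_near_normc x ch e20.
  (* Halving the radius keeps both [x'] and [y] within [r] of [x]. *)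
  exists (ball x (r / 2), [set d | d < r / 2]) => /=.
    split; first by apply: nbhsx_ballx; lra.
    by apply: nbhs_right_lt; lra.
  move=> [x' d] /= [xx' dr] y x'y.
  have h1 : normc (h x - h x') <= e / 2 by apply: hr; apply: le_ball xx'; lra.
  have h2 : normc (h x - h y) <= e / 2.
    apply: hr; rewrite /ball/= in xx' *.
    by have := ler_distD x' x y; lra.
  rewrite -(subrKA (h x)) (le_trans (le_normcD _ _))//.
  by rewrite -normcN opprB; lra.
move=> near_d.
have : \forall d \near 0^'+, 0 < d /\ d < 1 /\
    forall x, `[- (N + 1), N + 1]%classic x ->
    forall y, `|x - y| < d -> normc (h x - h y) <= e.
  near=> d; split; first by near: d; exact: nbhs_right_gt.
  by split; near: d; [exact: nbhs_right_lt|exact: near_d].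
move=> /filter_ex [d [d0 [d1 hd]]]; exists d => // x y xy.
have [xN|xN] := leP `|x| (N + 1).
  by apply: hd => //=; rewrite in_itv/= -ler_norml.
rewrite !hN ?subrr ?normcR ?normr0 ?ltW//; last by lra.
by have := ler_distD 0 x y; have := lerB_dist x y; lra.
Unshelve. all: by end_near. Qed.

(* Piecewise linear interpolation at equidistant knots: the [hat] functions form
   a partition of unity. *)
Lemma wapprox_Cc k h : (0 < k)%N -> Cc h -> wapprox k (H_ReLU k) h.
Proof.
(* The hats belong only to the weighted closure of the span, so the approximant is sought there. *)
move=> k0 hC; apply: wapprox_idem => e e0.
have [N N0 hN] := Cc_support hC; have [d d0 hd] := Cc_unif hC e0.
(* Since [n] exceeds 2N/d, the knots [t 0], ..., [t n] with spacing [d] reach from -N past N. *)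
pose n := (Num.truncn (2 * N / d)).+1.
pose t i : R := i%:R * d - N.
exists (fun x => \sum_(i < n.+1) h (t i) * (hat ((x - t i) / d))%:C).
  apply: (submodule_sum (fun i : 'I_n.+1 => h (t i))
    (f := fun i x => (hat ((x - t i) / d))%:C)).
    exact: submodule_wapprox_H.
  by move=> i; exact: wapprox_hat.
move=> x; pose y := (x + N) / d.
have tE i : (x - t i) / d = y - i%:R by rewrite /t /y; field; lra.
have S1 : \sum_(i < n.+1) hat (y - i%:R) <= 1.
  by rewrite sum_hat; have := ramp_ge0 (y - n%:R); have := ramp_le1 (y + 1); lra.
(* Where [|x| < N] the hats sum to 1; elsewhere [h x = 0]. *)
have hS : h x = \sum_(i < n.+1) h x * (hat ((x - t i) / d))%:C.
  have [/hN ->|xN] := leP N `|x|; first by rewrite big1// => i _; rewrite mul0r.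
  rewrite -mulr_sumr (_ : \sum_(i < _) _ = 1) ?mulr1//.
  under eq_bigr do rewrite tE.
  rewrite -rmorph_sum sum_hat; move: xN; rewrite ltr_norml => /andP[xN1 xN2].
  have y0 : 0 <= y by rewrite divr_ge0; lra.
  have yn : y <= n%:R.
    apply: (@le_trans _ _ (2 * N / d)); first by rewrite ler_pM2r ?invr_gt0//; lra.
    by rewrite /n ltW// truncnS_gt.
  by rewrite ramp_eq1 ?ramp_eq0 ?subr0//; lra.
rewrite [in h x - _]hS -sumrB; apply: (le_trans (normc_sum _)).
apply: (@le_trans _ _ (\sum_(i < n.+1) e * hat (y - i%:R))).
  apply: ler_sum => i _; rewrite -mulrBl normcM normcR tE ger0_norm ?hat_ge0//.
  (* A hat contributes only if its knot is closer than [d] to [x], where uniform continuity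
     applies. *)
  have [yi|yi] := leP 1 `|y - i%:R|; first by rewrite hat_eq0// !mulr0.
  rewrite ler_wpM2r ?hat_ge0// hd//; move: yi.
  by rewrite -tE normrM normfV (gtr0_norm d0) ltr_pdivrMr// mul1r.
rewrite -mulr_sumr ler_wpM2l ?(ltW e0)//; apply: (le_trans S1).
by rewrite lerDl exprn_ge0.
Qed.

(** * Limits at infinity and membership in Y_k *)

Lemma cvg_real_complex (T : Type) (F : set_system T) (u : T -> R) (l : R) : Filter F ->
  u @ F --> l -> (u x)%:C @[x --> F] --> (l%:C : R[i]^o).
Proof.
move=> FF /cvgrPdist_le ul; apply/(@cvgrPdist_le _ R[i]^o) => -[e e'].
rewrite ltcE/= => /andP[/eqP -> e0]; apply: filterS (ul _ e0) => x.
by rewrite -rmorphB -lecR -normcR.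
Qed.

Lemma continuous_ReLU k (a b : R) : continuous (fun x => ReLU k (a * x + b)).
Proof.
move=> x.
apply: (@continuous_comp R R R (fun x => Num.max 0 (a * x + b)) (fun y => y ^+ k));
  last exact: exprn_continuous.
apply: continuous_max; first exact: cvg_cst.
by apply: cvgD; [apply: cvgMl_tmp; exact: cvg_id|exact: cvg_cst].
Qed.

Lemma growth_quotient_lin k (F : set_system R) f g
    (a b : R[i]^o) (c : R[i]) :
  Filter F -> growth_quotient k f x @[x --> F] --> a ->
  growth_quotient k g x @[x --> F] --> b ->
  growth_quotient k (fun x => c * f x + g x) x @[x --> F] --> (c * a + b : R[i]^o).
Proof.
move=> FF fa gb.
rewrite (_ : growth_quotient _ _ =
    (fun x => c *: growth_quotient k f x) + growth_quotient k g).
  apply: (@cvgD _ R[i]^o); last exact: gb.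
  by apply: (@cvgZl_tmp _ R[i]^o); exact: fa.
by apply/funext=> x; rewrite /growth_quotient mulrDl -mulrA.
Qed.

Lemma submodule_Yk k : submodule (@Yk R k).
Proof.
split.
  have q0 : growth_quotient k (fun=> 0 : R[i]) = (fun=> 0).
    by apply/funext => x; rewrite /growth_quotient mul0r.
  by split; [move=> x; exact: cvg_cst| rewrite q0; exact: is_cvg_cst..].
move=> c f g [cf fp fm] [cg gp gm]; split.
- move=> x.
  apply: (@cvgD _ R[i]^o _ _ _ (fun y => c *: (f y : R[i]^o)) g); last exact: cg.
  by apply: (@cvgZl_tmp _ R[i]^o); exact: cf.
- by apply/cvg_ex; eexists; apply: growth_quotient_lin; [exact: fp|exact: gp].
- by apply/cvg_ex; eexists; apply: growth_quotient_lin; [exact: fm|exact: gm].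
Qed.

(** For [x > 0], dividing by x^k turns the quotient into a function of 1/x that is continuous at 0;
    its value there is the limit. *)
Lemma growth_ReLU_pinfty k (a b : R) : (0 < k)%N ->
  growth_quotient k (fun x => (ReLU k (a * x + b))%:C) x @[x --> +oo] -->
  ((ReLU k a)%:C : R[i]^o).
Proof.
move=> k0.
rewrite (_ : growth_quotient _ _ =
    fun x => (ReLU k (a * x + b) / (1 + `|x| ^+ k))%:C); last first.
  by apply/funext => x; rewrite /growth_quotient -fmorphV -rmorphM.
apply: cvg_real_complex.
have inv0 : x^-1 @[x --> +oo] --> (0 : R).
  apply/gtr0_cvgV0; last exact: cvg_id.
  exact: nbhs_pinfty_gt.
apply: cvg_trans (_ : ReLU k (b * x^-1 + a) / (1 + x^-1 ^+ k) @[x --> +oo] --> _).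
  apply: near_eq_cvg; near=> x.
  have x0 : 0 < x by near: x; exact: nbhs_pinfty_gt.
  rewrite gtr0_norm// /ReLU.
  have -> : b * x^-1 + a = x^-1 * (a * x + b) by field; lra.
  rewrite -[X in Num.max X _](mulr0 x^-1) -maxr_pMr ?invr_ge0 ?ltW// exprMn exprVn.
  have xk : 0 < x ^+ k by rewrite exprn_gt0.
  by field; rewrite !lt0r_neq0 ?addr_gt0.
rewrite -[X in _ --> X]mulr1; apply: cvgM.
  rewrite -[X in _ --> ReLU k X]add0r -[X in ReLU k (X + a)](mulr0 b).
  apply: (@continuous_cvg _ R R _ _ _ (fun y => ReLU k (b * y + a)) 0 _ inv0).
  exact: continuous_ReLU.
rewrite -[X in _ --> X]invr1; apply: cvgV; first exact: oner_neq0.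
rewrite -[X in _ --> X](addr0 1); apply: cvgD; first exact: cvg_cst.
(* Here [0 < k] enters: 0^0 would be 1. *)
have -> : 0 = (0 : R) ^+ k by rewrite expr0n eqn0Ngt k0.
by apply: (@continuous_cvg _ R R _ _ _ (fun y => y ^+ k) 0 _ inv0);
  exact: exprn_continuous.
Unshelve. all: by end_near. Qed.

(** Reflection of the limit at +oo under x -> -x. *)
Lemma growth_ReLU_ninfty k (a b : R) : (0 < k)%N ->
  growth_quotient k (fun x => (ReLU k (a * x + b))%:C) x @[x --> -oo] -->
  ((ReLU k (- a))%:C : R[i]^o).
Proof.
move=> k0.
rewrite (_ : growth_quotient _ _ = growth_quotient k
    (fun x => (ReLU k (- a * x + b))%:C) \o -%R).
  apply: cvg_comp _ (@growth_ReLU_pinfty k (- a) b k0).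
  by move=> A; rewrite -(@ninftyN R).
by apply/funext => x; rewrite /growth_quotient/= mulrNN normrN.
Qed.

Lemma Yk_ReLU k (a b : R) : (0 < k)%N -> Yk k (fun x => (ReLU k (a * x + b))%:C).
Proof.
move=> k0; split.
- by move=> x; apply: (@cvg_real_complex R (nbhs x) (fun y => ReLU k (a * y + b)));
    exact: continuous_ReLU.
- by apply/cvg_ex; eexists; exact: growth_ReLU_pinfty.
- by apply/cvg_ex; eexists; exact: growth_ReLU_ninfty.
Qed.

Lemma H_ReLU_Yk k : (0 < k)%N -> H_ReLU k `<=` @Yk R k.
Proof.
move=> k0 _ [n [c [g [Hg ->]]]]; apply: submodule_sum; first exact: submodule_Yk.
by move=> i; have [a [b [_ ->]]] := Hg i; exact: Yk_ReLU.
Qed.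

Lemma ReLUpE k : ReLUp k = fun x : R => (ReLU k (1 * x + 0))%:C.
Proof. by apply/funext => x; rewrite mul1r addr0. Qed.

Lemma ReLUmE k : ReLUm k = fun x : R => (ReLU k (-1 * x + 0))%:C.
Proof. by apply/funext => x; rewrite mulN1r addr0. Qed.

Lemma Yk_ReLUp k : (0 < k)%N -> Yk k (@ReLUp R k).
Proof. by move=> k0; rewrite ReLUpE; exact: Yk_ReLU. Qed.

Lemma Yk_ReLUm k : (0 < k)%N -> Yk k (@ReLUm R k).
Proof. by move=> k0; rewrite ReLUmE; exact: Yk_ReLU. Qed.

Lemma Cc_Yk k : @Cc R `<=` Yk k.
Proof.
move=> h hC; have [ch _] := hC; have [N N0 hN] := Cc_support hC; split=> //.
- apply/cvg_ex; exists (0 : R[i]^o); apply: cvg_near_cst; near=> x.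
  rewrite /growth_quotient hN ?mul0r//; apply: (le_trans _ (ler_norm _)).
  by near: x; apply: nbhs_pinfty_ge; exact: num_real.
- apply/cvg_ex; exists (0 : R[i]^o); apply: cvg_near_cst; near=> x.
  rewrite /growth_quotient hN ?mul0r// -normrN.
  apply: (le_trans _ (ler_norm _)); rewrite lerNr.
  by near: x; apply: nbhs_ninfty_le; exact: num_real.
Unshelve. all: by end_near. Qed.

Lemma ReLU_pm_Cc_Yk k : (0 < k)%N -> ReLU_pm_Cc k `<=` @Yk R k.
Proof.
move=> k0 _ [a [b [h [/(@Cc_Yk k) hY ->]]]]; have [_ Ylin] := submodule_Yk k.
rewrite (_ : (fun x => _) = fun x => a * ReLUp k x + (b * ReLUm k x + h x)).
  exact: (Ylin _ _ _ (Yk_ReLUp k0) (Ylin _ _ _ (Yk_ReLUm k0) hY)).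
by apply/funext => x; rewrite addrA.
Qed.

Lemma ReLU_pm_Cc_approx k : (0 < k)%N -> @ReLU_pm_Cc R k `<=` wapprox k (H_ReLU k).
Proof.
move=> k0 _ [a [b [h [hC ->]]]].
have [_ Wlin] := submodule_wapprox_H k.
rewrite (_ : (fun x => _) = fun x => a * ReLUp k x + (b * ReLUm k x + h x)).
  apply: (Wlin); [|apply: (Wlin); last exact: wapprox_Cc]; apply: wapprox_sub.
    by rewrite ReLUpE; apply: H_ReLU_affine; exact: oner_neq0.
  by rewrite ReLUmE; apply: H_ReLU_affine; rewrite oppr_eq0 oner_neq0.
by apply/funext => x; rewrite addrA.
Qed.

(** * Approximation of Y_k by cutoffs *)

Lemma growth_le_near k (F : set_system R) g (e : R) : Filter F -> 0 < e ->
  growth_quotient k g x @[x --> F] --> (0 : R[i]^o) ->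
  \forall x \near F, normc (g x) <= e * (1 + `|x| ^+ k).
Proof.
move=> FF e0 /cvgrPdist_le/(_ e%:C); rewrite ltcR => /(_ e0); apply: filterS => x.
rewrite sub0r normrN lecR -/(normc _) normcM normcV normcR.
by rewrite gtr0_norm ?weight_gt0// ler_pdivrMr ?weight_gt0.
Qed.

Lemma ramp_continuous : continuous ramp.
Proof.
rewrite (_ : ramp = fun y => ReLU 1 (1 * y + 0) - ReLU 1 (1 * y - 1)).
  by move=> x; apply: cvgB; exact: continuous_ReLU.
by apply/funext => y; rewrite !ReLU1E mul1r addr0.
Qed.

(** The factor is 1 for |x| <= N and 0 for |x| >= N + 1. *)
Lemma Cc_cutoff (N : R) g : continuous (g : R -> R[i]^o) ->
  Cc (fun x => (ramp (N + 1 - `|x|))%:C * g x).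
Proof.
move=> cg; split.
  move=> x; apply: (@cvgZ _ R[i]^o); last exact: cg.
  apply: cvg_real_complex.
  apply: (@continuous_comp R R R (fun x => N + 1 - `|x|) ramp);
    last exact: ramp_continuous.
  by apply: cvgB; [exact: cvg_cst|exact: norm_continuous].
apply: (subclosed_compact _ (@segment_compact R (- (N + 1)) (N + 1))).
  exact: closed_closure.
have /closure_id -> : closed `[- (N + 1), N + 1]%classic by exact: interval_closed.
apply: closure_subset => x /=; apply: contra_neqT.
rewrite in_itv/= -ler_norml -ltNge => xN.
by rewrite ramp_eq0 ?mul0r//; lra.
Qed.

Lemma Yk_approx k : (0 < k)%N -> @Yk R k `<=` wapprox k (ReLU_pm_Cc k).
Proof.
move=> k0 f fY e e0; have [cf /cvg_ex[/= lp fp] /cvg_ex[/= lm fm]] := fY.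
(* The growth limits at +oo and -oo are 1 and 0 for [ReLUp], 0 and 1 for [ReLUm], so both limits of
   [g] are 0. *)
pose g x := - lp * ReLUp k x + (- lm * ReLUm k x + f x).
have [_ Ylin] := submodule_Yk k.
have [cg _ _] : Yk k g.
  exact: (Ylin _ _ _ (Yk_ReLUp k0) (Ylin _ _ _ (Yk_ReLUm k0) fY)).
have R1 : ReLU k 1 = 1 :> R by rewrite /ReLU max_r ?expr1n.
have RN1 : ReLU k (-1) = 0 :> R by rewrite /ReLU max_l ?expr0n ?eqn0Ngt ?k0 ?lerN10.
have gp : growth_quotient k g x @[x --> +oo] --> (0 : R[i]^o).
  have -> : 0 = - lp * (ReLU k 1)%:C + (- lm * (ReLU k (-1))%:C + lp) :> R[i]^o.
    by rewrite R1 RN1; ring.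
  have Lp := @growth_ReLU_pinfty k 1 0 k0; have Lm := @growth_ReLU_pinfty k (-1) 0 k0.
  rewrite -ReLUpE in Lp; rewrite -ReLUmE in Lm.
  exact: (growth_quotient_lin _ Lp (growth_quotient_lin _ Lm fp)).
have gm : growth_quotient k g x @[x --> -oo] --> (0 : R[i]^o).
  have -> : 0 = - lp * (ReLU k (-1))%:C + (- lm * (ReLU k (- - 1))%:C + lm) :> R[i]^o.
    by rewrite opprK R1 RN1; ring.
  have Lp := @growth_ReLU_ninfty k 1 0 k0; have Lm := @growth_ReLU_ninfty k (-1) 0 k0.
  rewrite -ReLUpE in Lp; rewrite -ReLUmE in Lm.
  exact: (growth_quotient_lin _ Lp (growth_quotient_lin _ Lm fm)).
have [Mp [_ hp]] := growth_le_near _ e0 gp.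
have [Mm [_ hm]] := growth_le_near _ e0 gm.
(* [N < |x|] forces [x] above [Mp] or below [Mm], according to its sign. *)
pose N := Num.max Mp (- Mm).
have hN x : N < `|x| -> normc (g x) <= e * (1 + `|x| ^+ k).
  rewrite gt_max => /andP[xp xm]; have [x0|x0] := leP 0 x.
    by apply: hp; rewrite -(ger0_norm x0).
  by apply: hm; rewrite -ltrN2 -(ltr0_norm x0).
exists (fun x => lp * ReLUp k x + lm * ReLUm k x + (ramp (N + 1 - `|x|))%:C * g x).
  exists lp, lm, (fun x => (ramp (N + 1 - `|x|))%:C * g x).
  exact: (conj (Cc_cutoff N cg) erefl).
move=> x; set r := ramp _.
(* The error is the part of [g] cut away: zero for |x| <= N, and at most |g| beyond, where [g] is
   small. *)
have -> : f x - (lp * ReLUp k x + lm * ReLUm k x + r%:C * g x) = (1 - r)%:C * g x.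
  have E (u a b c p m : R[i]) : u - (a * p + b * m + c * (- a * p + (- b * m + u))) =
    (1 - c) * (- a * p + (- b * m + u)) by ring.
  by rewrite [(1 - r)%:C]rmorphB; exact: E.
have [xN|/hN xN] := leP `|x| N.
  rewrite /r ramp_eq1 ?subrr ?mul0r ?normcR ?normr0; last by lra.
  by rewrite mulr_ge0 ?(ltW e0) ?(ltW (weight_gt0 _ _)).
rewrite normcM normcR (le_trans _ xN)//.
have r0 := ramp_ge0 (N + 1 - `|x|); have r1 := ramp_le1 (N + 1 - `|x|).
by rewrite ler_piMl ?normc_ge0// ger0_norm ?subr_ge0// gerBl.
Qed.

(** * Transfer to the norm of the lattice *)

Lemma class_ofB (Omega : set R) (f g : R -> R[i]) (u v : L0 Omega) :
  class_of f u -> class_of g v -> class_of (fun x => f x - g x) (u - v).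
Proof.
move=> fu gv; pose w := L0funD (repr u) (L0funZ (-1) (repr v)).
have -> : u - v = \pi_(L0 Omega) w.
  by rewrite -{1}[u]reprK -{1}[v]reprK [- _]L0_scaleE [LHS]L0_addE.
have ww := L0_reprK w; rewrite /class_of /ae_eq_on /ae_eq in fu gv ww *.
by near=> x => Ox /=; rewrite (near ww)//= (near fu)// (near gv)// mulN1r.
Unshelve. all: by end_near. Qed.

Lemma Yk_norm_ge0 k f : 0 <= Yk_norm k f.
Proof.
pose E := range (fun x => normc (f x) / (1 + `|x| ^+ k)); rewrite /Yk_norm -/E.
(* For an unbounded set [sup] takes its default value 0. *)
have [[_ uE]|nE] := pselect (has_sup E); last by rewrite sup_out.
apply: (le_trans _ (ub_le_sup uE (imageT _ (0 : R)))).
by rewrite divr_ge0 ?normc_ge0 ?(ltW (weight_gt0 _ _)).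
Qed.

Lemma Yk_on_norm_ge0 k Omega f : 0 <= Yk_on_norm k Omega f.
Proof.
pose E := [set Yk_norm k g | g in [set g | Yk k g /\ {in Omega, f =1 g}]].
rewrite /Yk_on_norm -/E; have [->|E0] := eqVneq E set0; first by rewrite inf0.
by apply: lb_le_inf; [exact/set0P|move=> _ [g _ <-]; exact: Yk_norm_ge0].
Qed.

Lemma Yk_on_norm_le k Omega f (e : R) : Yk k f ->
  (forall x, normc (f x) <= e * (1 + `|x| ^+ k)) -> Yk_on_norm k Omega f <= e.
Proof.
move=> fY fe; apply: (@le_trans _ _ (Yk_norm k f)).
  apply: ge_inf; last by exists f.
  by exists 0 => _ [g _ <-]; exact: Yk_norm_ge0.
apply: ge_sup; first by exists (normc (f 0) / (1 + `|0 : R| ^+ k)); exists 0.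
by move=> _ [x _ <-]; rewrite ler_pdivrMr ?weight_gt0.
Qed.

(** A representative in [A] is replaced by a nearby [g] in [B]: the embedding turns the weighted
    bound on [f - g] into an element [y] of small norm, and [x - y] is represented by [g]. *)
Lemma closure_elements_in k (Omega : set R) (X : banachLattice Omega) A B :
  Yk_embedded k X -> A `<=` Yk k -> B `<=` Yk k -> A `<=` wapprox k B ->
  closure (elements_in X (restrictions Omega A)) `<=`
  closure (elements_in X (restrictions Omega B)).
Proof.
move=> [M hM] AY BY AB.
(* Closure is idempotent, so it suffices to approximate the elements coming from [A] itself. *)
rewrite [X in _ `<=` X](closure_id _).1; last exact: closed_closure.
apply: closure_subset => x [f' [f Af f'f] f'x] U /nbhs_ballP[/= [e e']].
rewrite /= ltcE/= => /andP[/eqP -> e0] xU.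
have M0 := normr_ge0 M.
(* The embedding constant [M] may have any sign, hence the absolute value; the summand 1 avoids
   division by zero. *)
have d0 : 0 < e / 2 / (1 + `|M|) by rewrite !divr_gt0//; lra.
have [g Bg fg] := AB _ Af _ d0.
have fgY : Yk k (fun x => f x - g x).
  by apply: submoduleB; [exact: submodule_Yk|exact: AY|exact: BY].
have [y fgy yM] := hM _ (ex_intro2 _ _ _ fgY (fun _ _ => erefl)).
exists (x - y); split.
  (* On [Omega] this function agrees with [g], because [f'] agrees with [f] there. *)
  exists (fun z => f' z - (f z - g z)); last by rewrite linearB; exact: class_ofB.
  by exists g => // z zO; rewrite f'f// subKr.
apply: xU; rewrite -ball_normE /= subKr (le_lt_trans yM)// ltcR.
have := Yk_on_norm_le Omega fgY fg; have := Yk_on_norm_ge0 k Omega (fun x => f x - g x).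
set n := Yk_on_norm _ _ _ => n0 ne.
apply: (@le_lt_trans _ _ (`|M| * (e / 2 / (1 + `|M|)))).
  by rewrite (le_trans (ler_wpM2r n0 (ler_norm M)))// ler_wpM2l.
by rewrite mulrA ltr_pdivrMr; nra.
Qed.

End Approximation.

Theorem theorem1p4 (R : realType) (k : nat) (hk : (0 < k)%N)
    (Omega : set R) (hOmega : open Omega) (X : banachLattice Omega)
    (hX : Yk_embedded k X) :
  closure (elements_in X (restrictions Omega (H_ReLU k))) =
  closure (elements_in X (restrictions Omega (ReLU_pm_Cc k))).
Proof.
have HY := @H_ReLU_Yk R k hk; have WY := @ReLU_pm_Cc_Yk R k hk.
apply/seteqP; split; apply: (closure_elements_in hX) => //.
  exact: subset_trans HY (Yk_approx hk).
exact: ReLU_pm_Cc_approx.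
Qed.
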